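(* Let $X$ and $Y$ be real Hilbert spaces and let $f:X\to Y$ be a $C^1$ Fredholm map of index $0$. Let $\mu(x)$ denote either of the two numbers $\operatorname{Inj} df(x)$ or $\operatorname{Sur} df(x)$. Suppose that $f$ satisfies the Katriel condition: for some $y_0\in Y$, $\inf\{\mu(x): x\in X,\ |f(x)-y_0|<\varrho\}>0$ for all $\varrho>0$. Then for every $y\in Y$ the functional $F_y:X\to\mathbb{R}$, $F_y(x)=\frac12|f(x)-y|^2$, satisfies the PS-condition.
   Context: A $C^1$ map $f$ is Fredholm of index $0$ if for every $x\in X$ the derivative $df(x):X\to Y$ has finite-dimensional kernel and cokernel of equal dimension. $\operatorname{Inj} df(x)=\inf_{|v|=1}|df(x)v|$ and $\operatorname{Sur} df(x)=\inf_{|v^*|=1}|df(x)^*v^*|$. (If the Katriel condition holds for some $y_0$, it holds for all $y_0\in Y$; the infimum over the empty set is $+\infty$.) A $C^1$ functional $F:X\to\mathbb{R}$ satisfies the PS-condition if every sequence $\{x_n\}$ in $X$ such that $\{F(x_n)\}$ is bounded and $|\nabla F(x_n)|\to0$ contains a convergent subsequence. *)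

(* Defs.v *)
From HB Require Import structures.
From mathcomp Require Import all_boot all_order all_algebra.
From mathcomp Require Import all_classical all_reals all_analysis.
Export numFieldNormedType.Exports.
Import Order.TTheory GRing.Theory Num.Theory.

Set Implicit Arguments.
Unset Strict Implicit.
Unset Printing Implicit Defensive.

Local Open Scope classical_set_scope.
Local Open Scope ring_scope.

(* A real Hilbert space: a Banach space whose norm comes from an inner
   product, i.e. a positive definite symmetric bilinear form. *)
HB.mixin Record CompleteNormedModule_isHilbert (R : realType) U
    of CompleteNormedModule R U := {
  inner : {dot U for @idfun R} ;
  inner_norm : forall u : U, inner u u = `|u| ^+ 2 }.

#[short(type="hilbertType")]
HB.structure Definition Hilbert (R : realType) :=
  {U of CompleteNormedModule_isHilbert R U & CompleteNormedModule R U}.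

(* Operator norm, as an extended real (+oo when T is unbounded). *)
Definition opnorm (R : realType) (X Y : normedModType R) (T : X -> Y) : \bar R :=
  ereal_sup [set (`|T v|)%:E | v in [set v : X | `|v| <= 1]].

(* Continuity of the derivative is with respect to the operator norm. *)
Definition C1 (R : realType) (X Y : normedModType R) (f : X -> Y) : Prop :=
  (forall x, differentiable f x) /\
  (forall x, opnorm (fun v => 'd f z v - 'd f x v) @[z --> x] --> 0%E).

(* The subspace K has dimension n modulo its subspace W: the classes of
   e_0, ..., e_(n-1) form a basis of the quotient K / W. *)
Definition has_quotient_dim (R : realType) (V : lmodType R) (K W : set V)
    (n : nat) : Prop :=
  exists e : 'I_n -> V,
    [/\ forall i, K (e i),
        forall c : 'I_n -> R, W (\sum_(i < n) c i *: e i) -> forall i, c i = 0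
      & forall v, K v -> exists c : 'I_n -> R, W (v - \sum_(i < n) c i *: e i)].

Definition linear_ker (R : realType) (X Y : lmodType R) (T : {linear X -> Y}) :
  set X := T @^-1` [set 0].

Definition fredholm_index0 (R : realType) (X Y : lmodType R)
    (T : {linear X -> Y}) : Prop :=
  exists n : nat, has_quotient_dim (linear_ker T) [set 0] n /\
                  has_quotient_dim [set: Y] (range T) n.

Definition fredholm_map_index0 (R : realType) (X Y : normedModType R)
    (f : X -> Y) : Prop :=
  C1 f /\ forall x, fredholm_index0 ('d f x).

(* Both infima are +oo over the empty set (X, resp. Y, trivial). *)
Definition injectivity_modulus (R : realType) (X Y : normedModType R)
    (T : {linear X -> Y}) : \bar R :=
  ereal_inf [set (`|T v|)%:E | v in [set v : X | `|v| = 1]].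

(* v* ranges over the unit sphere of the topological dual of Y (a linear form
   with finite operator norm is continuous), and T^* v* = v* \o T is measured
   in the dual norm of X. *)
Definition surjectivity_modulus (R : realType) (X Y : normedModType R)
    (T : {linear X -> Y}) : \bar R :=
  ereal_inf [set opnorm (phi \o T : X -> R^o) |
              phi in [set phi : {linear Y -> R^o} | opnorm phi = 1%E]].

Definition katriel (R : realType) (X Y : normedModType R) (f : X -> Y)
    (mu : X -> \bar R) : Prop :=
  exists y0 : Y, forall rho : R, 0 < rho ->
    (0 < ereal_inf [set mu x | x in [set x | (`|f x - y0| < rho)%R]])%E.

(* The Riesz representative of 'd F x; it is unique, and it exists as soon as
   F is differentiable at x (otherwise the value is irrelevant). *)
Definition gradient (R : realType) (X : hilbertType R) (F : X -> R^o) (x : X) :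
    X :=
  xget 0 [set g : X | forall v : X, 'd F x v = inner g v].

Definition palais_smale (R : realType) (X : hilbertType R) (F : X -> R^o) :
    Prop :=
  C1 F /\
  forall x_ : nat -> X,
    (exists M : R, forall n, `|F (x_ n)| <= M) ->
    `|gradient F (x_ n)| @[n --> \oo] --> (0 : R) ->
    exists2 s : nat -> nat, {homo s : m n / (m < n)%N} & cvgn (x_ \o s).

(* Main.v *)
Require Import Defs.
From HB Require Import structures.
From mathcomp Require Import all_boot all_order all_algebra.
From mathcomp Require Import all_classical all_reals all_analysis.
From mathcomp Require Import lra ring.
Import Order.TTheory GRing.Theory Num.Theory.

(** The Katriel condition makes every [df(x)] invertible, with
    [c |v| <= |df(x) v|] for a constant [c] that is uniform where [f] is bounded:
    for the Sur modulus, [A A^*] is onto by Lax-Milgram, hence so is [A], and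
    index 0 gives injectivity. Since the gradient of [F_y] at [x] is
    [df(x)^* (f(x) - y)], a Palais-Smale sequence satisfies [f(x_n) --> y].
    It converges because [f] is a homeomorphism (Hadamard's theorem): the union
    of the open sets on which [f] is injective with an image star-shaped about
    [f(0)] is again such a set; lifts of rays are Lipschitz by the uniform
    expansion, so they reach their endpoints; hence this largest sheet is mapped
    onto [Y], and it is then closed and open in [X]. *)

Set Implicit Arguments.
Unset Strict Implicit.
Unset Printing Implicit Defensive.

Local Open Scope classical_set_scope.
Local Open Scope ring_scope.

(** * Hilbert spaces *)

Section InnerProduct.
Context (R : realType) (X : hilbertType R).
Implicit Types u v w : X.

Lemma innerC u v : inner u v = inner v u.
Proof. by rewrite (@hermC _ _ _ _ inner) /= expr0 mul1r. Qed.

Lemma innerDl u v w : inner (u + v) w = inner u w + inner v w.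
Proof. exact: linearDl. Qed.

Lemma innerZl a u w : inner (a *: u) w = a * inner u w.
Proof. exact: linearZl_LR. Qed.

Lemma innerDr u v w : inner w (u + v) = inner w u + inner w v.
Proof. by rewrite innerC innerDl !(innerC _ w). Qed.

Lemma innerZr a u w : inner w (a *: u) = a * inner w u.
Proof. by rewrite innerC innerZl innerC. Qed.

Lemma innerNl u w : inner (- u) w = - inner u w.
Proof. by rewrite -scaleN1r innerZl mulN1r. Qed.

Lemma innerBl u v w : inner (u - v) w = inner u w - inner v w.
Proof. by rewrite innerDl innerNl. Qed.

Lemma innerBr u v w : inner w (u - v) = inner w u - inner w v.
Proof. by rewrite innerC innerBl !(innerC _ w). Qed.

Lemma normD_sqr u v : `|u + v| ^+ 2 = `|u| ^+ 2 + 2 * inner u v + `|v| ^+ 2.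
Proof. by rewrite -!inner_norm innerDl !innerDr (innerC v u); ring. Qed.

Lemma normB_sqr u v : `|u - v| ^+ 2 = `|u| ^+ 2 - 2 * inner u v + `|v| ^+ 2.
Proof. by rewrite normD_sqr normrN innerC innerNl (innerC v) mulrN. Qed.

Lemma cauchy_schwarz u v : `|inner u v| <= `|u| * `|v|.
Proof.
have [->|v0] := eqVneq v 0.
  by rewrite -(subrr u) innerBr !subrr !normr0 mulr0.
have b0 : 0 < `|v| ^+ 2 by rewrite exprn_gt0 // normr_gt0.
set a := inner u v.
(* Up to the factor [|v|^2], which avoids a division, this is the component of [u] orthogonal to
   [v]. *)
have : 0 <= `|(`|v| ^+ 2) *: u - a *: v| ^+ 2 by rewrite exprn_ge0.
rewrite -inner_norm innerBl !innerBr !innerZl !innerZr -/a (innerC v u) -/a.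
rewrite !inner_norm.
rewrite [leRHS](_ : _ = `|v| ^+ 2 * (`|v| ^+ 2 * `|u| ^+ 2 - a ^+ 2)); last by ring.
rewrite pmulr_rge0 // subr_ge0 => le.
rewrite -(@ler_pXn2r _ 2) ?nnegrE ?mulr_ge0 // exprMn real_normK ?num_real //.
by rewrite mulrC.
Qed.

Lemma inner_injl u v : (forall w, inner u w = inner v w) -> u = v.
Proof.
move=> uv; apply/eqP; rewrite -subr_eq0 -normr_eq0 -sqrf_eq0 -inner_norm.
by rewrite innerBl uv subrr.
Qed.

Lemma continuous_inner u : continuous (inner u : X -> R^o).
Proof.
move=> v; apply/cvgrPdist_le => e e0.
have u1 : 0 < `|u| + 1 by rewrite ltr_pwDr.
near=> w.
rewrite -innerBr (le_trans (cauchy_schwarz _ _)) //.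
rewrite (@le_trans _ _ ((`|u| + 1) * `|v - w|)) ?ler_wpM2r ?lerDl //.
rewrite -ler_pdivlMl //; near: w; apply: cvgr_dist_le => //.
by rewrite mulr_gt0 ?invr_gt0.
Unshelve. all: by end_near. Qed.

Lemma inner_is_linear u : linear (inner u : X -> R^o).
Proof. by move=> a v w; rewrite innerDr innerZr. Qed.

End InnerProduct.

Lemma cauchy_rate_cvg (R : realType) (X : completeNormedModType R)
    (x : nat -> X) (d : nat -> R) :
  d n @[n --> \oo] --> 0 ->
  (forall n m, (n <= m)%N -> `|x n - x m| <= d n) -> cvgn x.
Proof.
move=> d0 xd; apply/cauchy_cvgP/cauchy_exP => e e0.
have [N _ dN] : \forall n \near \oo, `|d n| < e.
  by have /cvgr0Pnorm_lt := d0; apply.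
exists (x N), N => // k Nk; rewrite -ball_normE /=.
by rewrite (le_lt_trans (xd _ _ Nk)) // (le_lt_trans (ler_norm _)) ?dN /=.
Qed.

Lemma continuous_linear_bound (R : realType) (X Y : normedModType R)
    (T : {linear X -> Y}) :
  continuous T -> exists2 C, 0 < C & forall v, `|T v| <= C * `|v|.
Proof.
by move=> /linear_bounded_continuous/linear_boundedP/pinfty_ex_gt0[C C0 TC]; exists C.
Qed.

(* [g] minimises the functional [v |-> |B v|^2 - 2 phi v], whose minimising
   sequences are Cauchy by the parallelogram identity. *)
Lemma lax_milgram (R : realType) (X Z : hilbertType R) (B : {linear X -> Z})
    (phi : {linear X -> R^o}) (c : R) :
  continuous B -> continuous phi -> 0 < c -> (forall v, c * `|v| <= `|B v|) ->
  exists g, forall v, inner (B g) (B v) = phi v.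
Proof.
move=> cB cphi c0 hc.
have [D D0 hD] := continuous_linear_bound cphi.
pose J v : R := `|B v| ^+ 2 - 2 * phi v.
have Jlb v : - (D / c) ^+ 2 <= J v.
  have h1 : (c * `|v|) ^+ 2 <= `|B v| ^+ 2.
    by rewrite ler_pXn2r ?nnegrE ?mulr_ge0 // ltW.
  have h2 : phi v <= D * `|v| by rewrite (le_trans (ler_norm _)).
  have h3 : 0 <= (c * `|v| - D / c) ^+ 2 by rewrite sqr_ge0.
  have h4 : (c * `|v| - D / c) ^+ 2 = (c * `|v|) ^+ 2 - 2 * (D * `|v|) + (D / c) ^+ 2.
    by field; rewrite gt_eqF.
  by rewrite /J; lra.
set m := inf (range J).
have hasJ : has_inf (range J).
  split; first by exists (J 0), 0.
  by exists (- (D / c) ^+ 2) => _ [v _ <-].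
have mJ v : m <= J v by apply: ge_inf; [exact: hasJ.2|exists v].
have par u v : c ^+ 2 * `|u - v| ^+ 2 <= 2 * (J u - m) + 2 * (J v - m).
  have h1 : (c * `|u - v|) ^+ 2 <= `|B (u - v)| ^+ 2.
    by rewrite ler_pXn2r ?nnegrE ?mulr_ge0 // ltW.
  have := mJ (2^-1 *: (u + v)).
  rewrite /J !linearZ /= linearD [phi (u + v)]linearD normrZ exprMn.
  move: h1; rewrite linearB exprMn !normB_sqr normD_sqr.
  by rewrite ger0_norm ?invr_ge0 // /GRing.scale /=; lra.
(* The tolerance is chosen so that [par] yields [|v n - v k| <= harmonic n] for [n <= k]. *)
have /choice[v hv] : forall n, exists v, J v < m + c ^+ 2 / 4 * (harmonic n) ^+ 2.
  move=> n; have e0 : 0 < c ^+ 2 / 4 * (harmonic n) ^+ 2.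
    by rewrite mulr_gt0 ?divr_gt0 ?exprn_gt0 ?invr_gt0.
  by have [_ [v _ <-] ?] := inf_adherent e0 hasJ; exists v.
have hcv : cvgn v.
  apply: (@cauchy_rate_cvg _ _ _ (@harmonic R)); first exact: cvg_harmonic.
  move=> n k nk; rewrite -(@ler_pXn2r _ 2) ?nnegrE // ?invr_ge0 //.
  rewrite -(@ler_pM2l _ (c ^+ 2)) ?exprn_gt0 //.
  have := par (v n) (v k); have := hv n; have := hv k.
  have : c ^+ 2 * (harmonic k : R) ^+ 2 <= c ^+ 2 * harmonic n ^+ 2.
    rewrite ler_wpM2l ?sqr_ge0 //.
    by rewrite ler_pXn2r ?nnegrE ?invr_ge0 // lef_pV2 ?posrE // ler_nat.
  by lra.
set g := limn v in hcv; exists g.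
have Jg : J g <= m.
  have cJ : J (v n) @[n --> \oo] --> J g.
    apply: cvgB; last by apply: cvgM; [exact: cvg_cst|exact: (cvg_comp _ _ hcv (cphi g))].
    by rewrite expr2; apply: cvgM; apply: cvg_norm; exact: (cvg_comp _ _ hcv (cB g)).
  have ch : m + c ^+ 2 / 4 * (harmonic n) ^+ 2 @[n --> \oo] --> m.
    rewrite -[X in _ --> X]addr0; apply: cvgD; first exact: cvg_cst.
    rewrite -[X in _ --> X](mulr0 (c ^+ 2 / 4)); apply: cvgM; first exact: cvg_cst.
    by rewrite -[X in _ --> X](mulr0 0); apply: cvgM; exact: cvg_harmonic.
  apply: (ler_cvg_to cJ ch); apply: nearW => n; exact: ltW.
move=> w; apply/eqP; rewrite -subr_eq0; set s := inner _ _ - _.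
have key t : 0 <= 2 * t * s + t ^+ 2 * `|B w| ^+ 2.
  have := le_trans Jg (mJ (g + t *: w)).
  rewrite /J !linearD !linearZ /= normD_sqr innerZr normrZ exprMn real_normK ?num_real //.
  by rewrite /s /GRing.scale /=; lra.
set b := `|B w| ^+ 2 in key; have b0 : 0 <= b by rewrite sqr_ge0.
have b1 : 0 < b + 1 by lra.
(* The vertex of the quadratic would be [t = - s / b]; the denominator [b + 1] also covers
   [B w = 0], and the value is still negative unless [s = 0]. *)
have := key (- s / (b + 1)).
have -> : 2 * (- s / (b + 1)) * s + (- s / (b + 1)) ^+ 2 * b =
  - (s ^+ 2 * (b + 2) / (b + 1) ^+ 2) by field; rewrite gt_eqF.
rewrite oppr_ge0 pmulr_lle0 ?invr_gt0 ?exprn_gt0 // pmulr_lle0; last by lra.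
by move=> s0; rewrite -sqrf_eq0 eq_le s0 sqr_ge0.
Qed.

(** The case [B = id], [c = 1] of Lax-Milgram. *)
Lemma riesz (R : realType) (X : hilbertType R) (phi : {linear X -> R^o}) :
  continuous phi -> exists g, forall v, phi v = inner g v.
Proof.
move=> cphi.
have [||g hg] := @lax_milgram R X X idfun phi 1 _ cphi ltr01.
- by move=> x; exact: cvg_id.
- by move=> v; rewrite mul1r.
by exists g => v; rewrite -hg.
Qed.

(** * Bounds on operator norms *)

Section OperatorNorm.
Context (R : realType) (X Y : normedModType R).
Implicit Types T : X -> Y.

Lemma opnorm_ge T v : `|v| <= 1 -> (`|T v|%:E <= opnorm T)%E.
Proof. by move=> v1; apply: ereal_sup_ubound; exists v. Qed.

Lemma opnorm_le T (e : R) : 0 <= e -> (forall v, `|T v| <= e * `|v|) ->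
  (opnorm T <= e%:E)%E.
Proof.
move=> e0 Te; apply: ge_ereal_sup => _ [v v1 <-].
by rewrite lee_fin (le_trans (Te v)) // ler_piMr.
Qed.

Lemma opnorm_bound T (e : R) : (forall a v, T (a *: v) = a *: T v) ->
  (opnorm T <= e%:E)%E -> forall v, `|T v| <= e * `|v|.
Proof.
move=> TZ Te v; have [->|v0] := eqVneq v 0.
  by rewrite -[X in T X](scale0r 0) TZ scale0r !normr0 mulr0.
have nv0 : 0 < `|v| by rewrite normr_gt0.
have := le_trans (@opnorm_ge T (`|v|^-1 *: v) _) Te.
rewrite TZ lee_fin !normrZ normfV normr_id mulVf ?gt_eqF // => /(_ (lexx _)).
by rewrite mulrC ler_pdivrMr.
Qed.

End OperatorNorm.

(** * Injectivity and surjectivity in index 0 *)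

Section FredholmIndexZero.
Context (R : realType) (X Y : lmodType R) (T : {linear X -> Y}).
Hypothesis hT : fredholm_index0 T.

(** If the common dimension is 0, the empty family spans the cokernel. Otherwise the basis vectors
    of the kernel all vanish, so their sum is a nontrivial relation. The converse below exchanges
    the roles of kernel and cokernel. *)
Lemma index0_inj_surj : (forall v, T v = 0 -> v = 0) -> forall w, exists v, T v = w.
Proof.
have [[|n] [[e [ke fe _]] [e' [_ _ ge']]]] := hT => T0 w.
  by have [//|c] := ge' w; rewrite big_ord0 subr0 => -[v _ <-]; exists v.
have h : \sum_(i < n.+1) 1 *: e i = 0.
  by rewrite big1 // => i _; rewrite (T0 _ (ke i)) scaler0.
by have /eqP := fe (fun=> 1) h ord0; rewrite oner_eq0.
Qed.

Lemma index0_surj_inj : (forall w, exists v, T v = w) -> forall v, T v = 0 -> v = 0.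
Proof.
have [[|n] [[e [_ _ ge]] [e' [_ fe' _]]]] := hT => sT v Tv.
  by have [//|c] := ge v; rewrite big_ord0 subr0.
have h : range T (\sum_(i < n.+1) 1 *: e' i).
  by have [u uE] := sT (\sum_(i < n.+1) 1 *: e' i); exists u.
by have /eqP := fe' (fun=> 1) h ord0; rewrite oner_eq0.
Qed.

End FredholmIndexZero.

(** * Adjoints and the two moduli *)

Definition inner_form (R : realType) (X : hilbertType R) (u : X) :
    {linear X -> R^o} :=
  HB.pack (inner u : X -> R^o)
    (GRing.isLinear.Build R X R^o *:%R (inner u) (inner_is_linear u)).

Section Adjoint.
Context (R : realType) (X Y : hilbertType R) (A : {linear X -> Y}).
Hypothesis cA : continuous A.

(** Riesz defines [B] pointwise, and uniqueness of representatives makes it linear. It is bounded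
    because [|B w|^2 = <w, A (B w)> <= C |w| |B w|]. *)
Lemma exists_adjoint : exists2 B : {linear Y -> X}, continuous B &
  forall w v, inner (B w) v = inner w (A v).
Proof.
have /choice[B hB] : forall w, exists g, forall v, inner w (A v) = inner g v.
  move=> w; apply: (@riesz _ _ (inner_form w \o A)) => v.
  by apply: continuous_comp; [exact: cA|exact: continuous_inner].
have lB : linear B.
  move=> a u v; apply: inner_injl => w.
  by rewrite -hB !innerDl !innerZl !hB.
pose BL : {linear Y -> X} := HB.pack B (GRing.isLinear.Build R Y X *:%R B lB).
exists BL; last by move=> w v; rewrite -hB.
have [C C0 AC] := continuous_linear_bound cA.
apply/bounded_linear_continuous/linear_boundedP; near=> r => w.
have [->|Bw0] := eqVneq (BL w) 0; first by rewrite normr0 mulr_ge0.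
rewrite (@le_trans _ _ (C * `|w|)) //.
  rewrite -(@ler_pM2r _ `|BL w|) ?normr_gt0 // -expr2 -inner_norm -hB.
  rewrite (le_trans (ler_norm _)) // (le_trans (cauchy_schwarz _ _)) //.
  by rewrite -mulrA mulrCA ler_wpM2l.
by rewrite ler_wpM2r.
Unshelve. all: by end_near. Qed.

Lemma opnorm_inner_form (w : Y) : `|w| = 1 -> opnorm (inner_form w) = 1%E.
Proof.
move=> w1; apply/eqP; rewrite eq_le; apply/andP; split.
  by apply: opnorm_le => // v; rewrite -w1; exact: cauchy_schwarz.
rewrite (le_trans _ (@opnorm_ge _ _ _ _ w _)) ?w1 //=.
by rewrite inner_norm w1 expr1n normr1.
Qed.

(** Testing the modulus on the forms [inner w1] with [|w1| = 1] bounds the adjoint [B] below.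
    Lax-Milgram for [B] then solves [<B u, B v> = <w, v>] for all [v], which says [A (B u) = w]. *)
Lemma surjectivity_modulus_surj c : 0 < c ->
  (c%:E <= surjectivity_modulus A)%E ->
  exists2 B : {linear Y -> X}, forall w v, inner (B w) v = inner w (A v) &
  (forall w, c * `|w| <= `|B w|) /\ (forall w, exists u, A (B u) = w).
Proof.
move=> c0 cs; have [B cB hB] := exists_adjoint.
have Bc w : c * `|w| <= `|B w|.
  have [->|w0] := eqVneq w 0; first by rewrite normr0 mulr0.
  pose w1 := `|w|^-1 *: w.
  have w1E : `|w1| = 1 by rewrite normrZ normfV normr_id mulVf ?normr_eq0.
  have : (c%:E <= opnorm (inner_form w1 \o A : X -> R^o))%E.
    apply: (le_trans cs); apply: ereal_inf_lbound.
    by exists (inner_form w1) => //=; exact: opnorm_inner_form.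
  have h : (opnorm (inner_form w1 \o A : X -> R^o) <= `|B w1|%:E)%E.
    by apply: opnorm_le => // v /=; rewrite -hB; exact: cauchy_schwarz.
  move=> /le_trans/(_ h).
  by rewrite lee_fin linearZ normrZ normfV normr_id mulrC ler_pdivlMr ?normr_gt0.
exists B => //; split=> // w.
have [|u hu] := @lax_milgram _ _ _ B (inner_form w) c cB _ c0 Bc.
  exact: continuous_inner.
by exists u; apply: inner_injl => v; rewrite innerC -hB innerC hu.
Qed.

Lemma modulus_lower_bound c : fredholm_index0 A -> 0 < c ->
  (c%:E <= injectivity_modulus A)%E \/ (c%:E <= surjectivity_modulus A)%E ->
  (forall v, c * `|v| <= `|A v|) /\ (forall w, exists v, A v = w).
Proof.
move=> iA c0 [ci|cs].
  have Ac v : c * `|v| <= `|A v|.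
    have [->|v0] := eqVneq v 0; first by rewrite normr0 mulr0.
    have : (c%:E <= `|A (`|v|^-1 *: v)|%:E)%E.
      apply: (le_trans ci); apply: ereal_inf_lbound; exists (`|v|^-1 *: v) => //=.
      by rewrite normrZ normfV normr_id mulVf ?normr_eq0.
    by rewrite lee_fin linearZ normrZ normfV normr_id mulrC ler_pdivlMr ?normr_gt0.
  split=> //; apply: (index0_inj_surj iA) => v Av.
  by apply/eqP; have := Ac v; rewrite Av normr0 pmulr_rle0 // normr_le0.
have [B hB [Bc AB]] := surjectivity_modulus_surj c0 cs.
have sA w : exists v, A v = w by have [u <-] := AB w; exists (B u).
split=> // v; have [u uE] := AB (A v).
have vE : v = B u.
  apply/eqP; rewrite -subr_eq0; apply/eqP/(index0_surj_inj iA sA).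
  by rewrite linearB uE subrr.
have [->|v0] := eqVneq v 0; first by rewrite normr0 mulr0.
have nv0 : 0 < `|v| by rewrite normr_gt0.
(* With [v = B u]: [|v|^2 = <u, A v> <= |u| |A v|], while [c |u| <= |B u| = |v|]. *)
rewrite -(@ler_pM2r _ `|v|) // -mulrA -expr2 -inner_norm {1}vE hB.
rewrite (@le_trans _ _ (c * (`|u| * `|A v|))) //.
  by rewrite ler_pM2l // (le_trans (ler_norm _)) // cauchy_schwarz.
by rewrite mulrA mulrC ler_wpM2l // vE.
Qed.

End Adjoint.

(** * Local inversion *)

(** The scalar mean value theorem is applied to the pairing of the path with the error vector [w]
    itself, giving [|w|^2 = <w, ('d f - A) u>] at an intermediate point. *)
Lemma mean_value_inequality (R : realType) (X : normedModType R)
    (Y : hilbertType R) (f : X -> Y) (A : {linear X -> Y}) (a b : X) (e : R) :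
  (forall x, differentiable f x) ->
  (forall t, t \in `[0, 1] ->
    `|'d f (b + t *: (a - b)) (a - b) - A (a - b)| <= e * `|a - b|) ->
  `|f a - f b - A (a - b)| <= e * `|a - b|.
Proof.
move=> df fA; set u := a - b; set w := f a - f b - A u.
pose h (t : R) : X := b + t *: u.
pose g (t : R) : R^o := inner w (f (h t) - t *: A u).
have dg (t : R) : is_derive t 1 g (inner w ('d f (h t) u - A u)).
  have dh : is_diff t h ( *:%R^~ u).
    by rewrite -[X in is_diff t h X]add0r; apply: is_diffD.
  have dfh : is_diff (h t) f ('d f (h t)) by apply: DiffDef.
  have d1 := is_diff_comp dh dfh.
  have d2 := is_diffB d1 (is_diff_scalel t (A u)).
  have dw z : is_diff z (inner_form w) (inner_form w).
    by apply: DiffDef; [exact/linear_differentiable/continuous_inner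
      |rewrite diff_lin //; exact: continuous_inner].
  have d3 := is_diff_comp d2 (dw _).
  apply: DeriveDef; first exact/diff_derivable/(ex_diff (is_diff_def:=d3)).
  rewrite deriveE; last exact: (ex_diff (is_diff_def:=d3)).
  by rewrite (diff_val (is_diff_def:=d3)) /= !fctE /= !scale1r.
have [|c c01] := @MVT_segment R g _ 0 1 ler01 (fun t _ => dg t).
  by apply: derivable_within_continuous => t _; by case: (dg t).
rewrite subr0 mulr1 /g /h !scale1r !scale0r addr0 subr0 subrKC -innerBr.
rewrite addrAC inner_norm -/w => wE.
have [->|w0] := eqVneq w 0; first by rewrite normr0 (le_trans _ (fA _ c01)).
rewrite -(@ler_pM2l _ `|w|) ?normr_gt0 // -expr2 wE.
rewrite (le_trans (ler_norm _)) // (le_trans (cauchy_schwarz _ _)) //.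
by rewrite ler_wpM2l // fA.
Qed.

Section LocalInversion.
Context (R : realType) (X Y : hilbertType R) (f : X -> Y).
Hypothesis fC1 : C1 f.

Lemma C1_near (x : X) (e : R) : 0 < e ->
  \forall z \near x, forall v, `|'d f z v - 'd f x v| <= e * `|v|.
Proof.
move=> e0; have : \forall z \near x, (opnorm (fun v => 'd f z v - 'd f x v)%R < e%:E)%E.
  have e_nbhs : nbhs (0%E : \bar R) [set y | (y < e%:E)%E].
    apply: open_nbhs_nbhs; split; first exact: open_ereal_lt_ereal.
    by rewrite /= lte_fin.
  exact: (fC1.2 x _ e_nbhs).
apply: filterS => z ze; apply: opnorm_bound; last exact: ltW.
by move=> a v; rewrite linearZ [X in _ - X]linearZ scalerBr.
Qed.

Lemma C1_linear_approx (x : X) (e : R) : 0 < e ->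
  exists2 r, 0 < r & forall a b, `|x - a| <= r -> `|x - b| <= r ->
    `|f a - f b - 'd f x (a - b)| <= e * `|a - b|.
Proof.
move=> e0; have /nbhs_normP[r /= r0 hr] := C1_near x e0.
(* Points of the segment stay in the closed ball of radius [r / 2], hence in the open ball of radius
   [r]. *)
exists (r / 2); first by rewrite divr_gt0.
move=> a b xa xb; apply: mean_value_inequality; first exact: fC1.1.
move=> t /itvP t01; apply: hr => /=.
have -> : x - (b + t *: (a - b)) = t *: (x - a) + (1 - t) *: (x - b).
  rewrite opprD addrA scalerBl scale1r addrCA -scalerBr -scalerN.
  by rewrite !opprB [x - a + _]addrC addrA subrK.
rewrite (le_lt_trans (ler_normD _ _)) // !normrZ.
rewrite (ger0_norm (_ : 0 <= t)) ?(ger0_norm (_ : 0 <= 1 - t)) ?subr_ge0 ?t01 //.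
rewrite (@le_lt_trans _ _ (t * (r / 2) + (1 - t) * (r / 2))) //.
  by rewrite lerD // ler_wpM2l ?subr_ge0 ?t01.
by rewrite -mulrDl subrKC mul1r ltr_pdivrMr // ltr_pMr // ltr1n.
Qed.

Variables (x : X) (c : R).
Hypotheses (c0 : 0 < c) (dfc : forall v, c * `|v| <= `|'d f x v|).

(** A linearisation error of at most [c / 2] leaves half of the lower bound [c] of the
    derivative. *)
Lemma C1_locally_expanding : exists2 r, 0 < r &
  forall a b, `|x - a| <= r -> `|x - b| <= r -> c / 2 * `|a - b| <= `|f a - f b|.
Proof.
have c2 : 0 < c / 2 by rewrite divr_gt0.
have [r r0 hr] := C1_linear_approx x c2; exists r => // a b xa xb.
have := hr _ _ xa xb; have := dfc (a - b).
have := ler_normB (f a - f b) (f a - f b - 'd f x (a - b)).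
by rewrite subKr; lra.
Qed.

Lemma C1_locally_open : (forall w, exists v, 'd f x v = w) ->
  forall U, nbhs x U -> nbhs (f x) (f @` U).
Proof.
move=> /choice[S fS] U /nbhs_normP[r1 /= r10 xU].
have c2 : 0 < c / 2 by rewrite divr_gt0.
have [r2 r20 hr2] := C1_linear_approx x c2.
pose r := Num.min (r1 / 2) r2.
have r0 : 0 < r by rewrite lt_min divr_gt0.
have rr1 : r < r1.
  by rewrite gt_min ltr_pdivrMr // ltr_pMr // ltr1n.
have rr2 : r <= r2 by rewrite ge_min lexx orbT.
apply/nbhs_normP; exists (c / 2 * r); first by rewrite /= mulr_gt0.
move=> y /= yr; pose K := [set z : X | `|x - z| <= r].
(* Newton iteration with frozen derivative; its fixed points solve [f z = y]. [S] is only a choice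
   of preimages, so estimates are made after applying ['d f x], where [S] cancels, and pulled back
   by [dfc]. The error [c / 2] gives the contraction factor 1/2 and, with [|f x - y| < c / 2 * r],
   the stability of the ball [K]. *)
pose T z := z - S (f z - y).
have TK : {homo T : z / K z >-> K z}.
  move=> z Kz; rewrite /K /= distrC -(@ler_pM2l _ c) // (le_trans (dfc _)) //.
  have := hr2 z x (le_trans Kz rr2); rewrite subrr normr0 ltW // => /(_ isT) h.
  rewrite /T addrAC linearB fS.
  have -> : 'd f x (z - x) - (f z - y) = - ((f z - f x - 'd f x (z - x)) + (f x - y)).
    by rewrite [f z - f x - _]addrAC addrA subrK !opprB addrCA.
  rewrite normrN (le_trans (ler_normD _ _)) //.
  have : c / 2 * `|z - x| <= c / 2 * r by rewrite ler_pM2l // distrC.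
  by move: h yr; lra.
have ctrT : is_contraction (mkfun_fun TK).
  exists 2^-1%:nng; split; first by rewrite /= invf_lt1 // ltr1n.
  move=> [z z'] /= [Kz Kz'].
  rewrite -(@ler_pM2l _ c) // (le_trans (dfc _)) // mulrA.
  have -> : mkfun TK z - mkfun TK z' = (z - z') - (S (f z - y) - S (f z' - y)).
    by rewrite /mkfun /T opprD opprK addrACA opprB [- _ + _]addrC.
  rewrite linearB.
  have -> : 'd f x (S (f z - y) - S (f z' - y)) = f z - f z'.
    by rewrite linearB !fS opprB addrA subrK.
  have := hr2 z z' (le_trans Kz rr2) (le_trans Kz' rr2).
  by rewrite distrC.
have [||p Kp pE] := banach_fixed_point ctrT.
- have -> : K = closed_ball x r by rewrite closed_ballE.
  exact: closed_ball_closed.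
- by exists x; rewrite /K /= subrr normr0 ltW.
exists p; first by apply: xU; rewrite /= (le_lt_trans Kp).
have Sp0 : S (f p - y) = 0.
  apply: oppr_inj; apply: (addrI p); rewrite oppr0 addr0; exact/esym/pE.
by apply/eqP; rewrite -subr_eq0 -(fS (f p - y)) Sp0 linear0.
Qed.

End LocalInversion.

(** * Global inversion *)

Section RealInduction.
Context (R : realType).

Lemma near_left_point (a t : R) (Q : R -> Prop) : a < t ->
  (\forall s \near t, Q s) -> exists s, [/\ a <= s, s < t & Q s].
Proof.
move=> at_ /nbhs_normP[e /= e0 Qe]; exists (Num.max a (t - e / 2)).
have e2 : 0 < e / 2 by rewrite divr_gt0.
split; first by rewrite le_max lexx.
  by rewrite gt_max at_ ltrBlDr ltrDl.
apply: Qe => /=; rewrite ger0_norm ?subr_ge0 ?ge_max ?(ltW at_) ?gerBl ?ltW //.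
have : t - e / 2 <= Num.max a (t - e / 2) by rewrite le_max lexx orbT.
by lra.
Qed.

(** With [m] the supremum of the [t] such that [P] holds on [[a, t]], the closure hypothesis gives
    [P m], and the openness hypothesis passes beyond [m] unless [m = b]. *)
Lemma real_induction (P : R -> Prop) (a b : R) : a <= b -> P a ->
  (forall t, a <= t < b -> P t -> \forall s \near t, t < s -> s <= b -> P s) ->
  (forall t, a < t <= b -> (forall s, a <= s < t -> P s) -> P t) -> P b.
Proof.
move=> ab Pa Popen Pclosed.
pose B : set R := [set t | a <= t <= b /\ forall s, a <= s <= t -> P s].
have Ba : B a by split; rewrite ?lexx // => s; rewrite -eq_le => /eqP <-.
have supB : has_sup B by split; [exists a|exists b => t [/andP[]]].
set m := sup B.
have am : a <= m by apply: ub_le_sup => //; exact: supB.2.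
have mb : m <= b by apply: ge_sup; [exists a|move=> t [/andP[]]].
have Pltm s : a <= s < m -> P s.
  move=> /andP[as_ sm]; have ms0 : 0 < m - s by rewrite subr_gt0.
  have [t [_ Pt] st] := sup_adherent ms0 supB.
  by apply: Pt; rewrite as_ ltW //; move: st; rewrite subKr.
have Pm : P m.
  have [->//|am'] := eqVneq m a.
  by apply: Pclosed => //; rewrite lt_neqAle eq_sym am' am.
have [<-//|mb'] := eqVneq m b.
have {}mb' : m < b by rewrite lt_neqAle mb' mb.
have /nbhs_normP[e /= e0 Pe] : \forall s \near m, m < s -> s <= b -> P s.
  by apply: Popen => //; rewrite am mb'.
pose m1 := Num.min b (m + e / 2).
have e2 : 0 < e / 2 by rewrite divr_gt0.
have mm1 : m < m1 by rewrite lt_min mb' ltrDl.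
have m1e : m1 <= m + e / 2 by rewrite ge_min lexx orbT.
have m1b : m1 <= b by rewrite ge_min lexx.
suff Bm1 : B m1.
  by have := ub_le_sup supB.2 Bm1; rewrite leNgt mm1.
split; first by rewrite (le_trans am (ltW mm1)).
move=> s /andP[as_ sm1]; have [sm|ms|->//] := ltgtP s m.
  by apply: Pltm; rewrite as_.
apply: Pe => //=; last exact: le_trans m1b.
by rewrite distrC gtr0_norm ?subr_gt0 //; lra.
Qed.

End RealInduction.

Lemma segment_in_ball (R : realType) (Y : normedModType R) (w y v : Y)
    (e t s : R) : t <= s <= 1 ->
  `|w - (y + t *: v)| < e -> `|w - (y + v)| < e -> `|w - (y + s *: v)| < e.
Proof.
move=> /andP[ts s1] wt w1; have [tE|t1] := eqVneq t 1.
  have -> // : s = t by apply/eqP; rewrite eq_le ts tE s1.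
have {}t1 : t < 1 by rewrite lt_neqAle t1 (le_trans ts).
have t10 : 0 < 1 - t by rewrite subr_gt0.
rewrite -(@ltr_pM2l _ (1 - t)) // -{1}(gtr0_norm t10) -normrZ.
(* The point at [s] is a convex combination of those at [t] and 1, here with denominators
   cleared. *)
have -> : (1 - t) *: (w - (y + s *: v)) =
    (1 - s) *: (w - (y + t *: v)) + (s - t) *: (w - (y + v)).
  rewrite !opprD !addrA ![_ *: (_ - _ *: v)]scalerBr.
  rewrite ![(s - t) *: (_ - v)]scalerBr !scalerA addrACA -scalerDl -opprD -scalerDl.
  by congr (_ *: _ - _ *: _); ring.
rewrite (le_lt_trans (ler_normD _ _)) // !normrZ.
rewrite !ger0_norm ?subr_ge0 //.
have [s1E|s1'] := eqVneq s 1.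
  by rewrite s1E subrr mul0r add0r ltr_pM2l.
have {}s1' : 0 < 1 - s by rewrite subr_gt0 lt_neqAle s1' s1.
have : (1 - s) * `|w - (y + t *: v)| < (1 - s) * e by rewrite ltr_pM2l.
have : (s - t) * `|w - (y + v)| <= (s - t) * e by rewrite ler_wpM2l ?subr_ge0 // ltW.
by lra.
Qed.

Lemma continuous_ray (R : realType) (Y : normedModType R) (y v : Y) :
  continuous (fun t : R => y + t *: v).
Proof. by move=> t; apply: cvgD; [exact: cvg_cst|exact: scalel_continuous]. Qed.

(** * Lifting rays through radial sheets *)

Section GlobalInversion.
Context (R : realType) (X : completeNormedModType R) (Y : normedModType R).
Variable f : X -> Y.
Hypothesis f_cont : continuous f.
Hypothesis f_open : forall x U, nbhs x U -> nbhs (f x) (f @` U).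
Hypothesis f_expanding : forall rho : R, 0 < rho -> exists2 c, 0 < c &
  forall x, `|f x| < rho ->
  exists2 r, 0 < r & forall a b, `|x - a| <= r -> `|x - b| <= r ->
    c * `|a - b| <= `|f a - f b|.

Definition inj_on (U : set X) := forall x x', U x -> U x' -> f x = f x' -> x = x'.

(** Uniqueness of lifts: the parameters at which the lifts into [U] and [V] coincide form an open
    set because [f] is open, and a closed one because [X] is Hausdorff. *)
Lemma lifts_agree (U V : set X) (y v : Y) (a b : R) : a <= b ->
  open U -> open V -> inj_on U -> inj_on V ->
  (forall t, a <= t <= b -> exists2 u, U u & f u = y + t *: v) ->
  (forall t, a <= t <= b -> exists2 u, V u & f u = y + t *: v) ->
  (exists x, [/\ U x, V x & f x = y + a *: v]) ->
  exists x, [/\ U x, V x & f x = y + b *: v].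
Proof.
move=> ab oU oV iU iV hU hV ha.
have near_image t x W : open W -> W x -> f x = y + t *: v ->
    \forall s \near t, exists2 z, W z & f z = y + s *: v.
  move=> oW Wx fx; have : nbhs (y + t *: v) (f @` W).
    by rewrite -fx; apply: f_open; apply: open_nbhs_nbhs; split.
  exact: (@continuous_ray _ _ y v t _).
apply: (real_induction (P := fun t => exists x, [/\ U x, V x & f x = y + t *: v])
  ab) => // t.
  move=> _ [x [Ux Vx fx]].
  have := near_image t x (U `&` V) (openI oU oV) (conj Ux Vx) fx.
  by apply: filterS => s [z [Uz Vz] fz] _ _; exists z.
move=> /andP[at_ tb] hs; have tab : a <= t <= b by rewrite ltW.
have [u Uu fu] := hU t tab; have [u' Vu' fu'] := hV t tab.
have [uu'|uu'] := eqVneq u u'; first by exists u; rewrite {2}uu'.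
(* If the lifts differ at [t], disjoint neighbourhoods separate them. Just before [t] each lift is
   in its own neighbourhood, yet both equal the common point given by [hs]. *)
have := @norm_hausdorff _ X; rewrite open_hausdorff => /(_ _ _ uu').
move=> [[A A'] [/set_mem Au /set_mem A'u'] [oA oA' AA']] /=.
have n1 := near_image t u (A `&` U) (openI oA oU) (conj Au Uu) fu.
have n2 := near_image t u' (A' `&` V) (openI oA' oV) (conj A'u' Vu') fu'.
have [s [as_ st [[z [Az Uz] fz] [z' [A'z' Vz'] fz']]]] :=
  near_left_point at_ (filterI n1 n2).
have [|x [Ux Vx fx]] := hs s; first by rewrite as_.
have xz : x = z by apply: iU => //; rewrite fx.
have xz' : x = z' by apply: iV => //; rewrite fx.
move/eqP in AA'; suff : (A `&` A') x by rewrite [A `&` A']AA'.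
by split; [rewrite xz|rewrite xz'].
Qed.

(** Expansion gives injectivity on a small ball and openness a ball inside its image; intersecting
    with the preimage of the latter makes the image exactly a ball, hence convex. *)
Lemma chart (x : X) : exists (N : set X) (e : R),
  [/\ open N, N x, inj_on N & 0 < e] /\
  [/\ forall z, N z -> `|f x - f z| < e &
      forall y, `|f x - y| < e -> exists2 z, N z & f z = y].
Proof.
have [|c c0 hc] := @f_expanding (`|f x| + 1); first by rewrite ltr_wpDl.
have /hc[r r0 hr] : `|f x| < `|f x| + 1 by rewrite ltrDl.
have /nbhs_normP[e /= e0 he] : nbhs (f x) (f @` ball x r).
  by apply: f_open; exact: nbhsx_ballx.
exists (ball x r `&` f @^-1` ball (f x) e), e; split; split.
- apply: openI; first exact: ball_open.
  by apply: open_comp; [move=> z _; exact: f_cont|exact: ball_open].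
- by split; exact: ballxx.
- move=> z z'; rewrite -!ball_normE /= => -[/ltW xz _] [/ltW xz' _] fzz'.
  have := hr _ _ xz xz'; rewrite fzz' subrr normr0 pmulr_rle0 // normr_le0.
  by rewrite subr_eq0 => /eqP.
- by [].
- by move=> z [_]; rewrite /preimage /= -ball_normE.
- move=> y xy; have [z xz fz] := he y xy; exists z => //.
  by split => //; rewrite /preimage /= fz -ball_normE.
Qed.

Variable a0 : X.
Let y0 := f a0.

(* The image of [U] is star-shaped about [y0]. *)
Definition radial (U : set X) := forall x t, U x -> 0 <= t <= 1 ->
  exists2 z, U z & f z = y0 + t *: (f x - y0).

Definition radial_sheet (U : set X) := [/\ open U, U a0, inj_on U & radial U].

Definition maximal_sheet : set X := \bigcup_(U in radial_sheet) U.

(** Both sheets lift the ray from [y0] to [f x], and both lifts start at [a0]. This is what keeps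
    [f] injective on unions of sheets. *)
Lemma radial_sheet_agree U V x x' : radial_sheet U -> radial_sheet V ->
  U x -> V x' -> f x = f x' -> x = x'.
Proof.
move=> [oU Ua iU rU] [oV Va iV rV] Ux Vx' fxx'.
have [|||z [Uz Vz]] := lifts_agree (y := y0) (v := f x - y0) ler01 oU oV iU iV.
- by move=> t; exact: rU.
- by move=> t; rewrite fxx'; exact: rV.
- by exists a0; rewrite scale0r addr0.
rewrite scale1r subrKC => fz.
by rewrite -(iU z x) // (iV z x') // fz.
Qed.

Lemma maximal_sheet_radial : radial_sheet maximal_sheet.
Proof.
split.
- by apply: bigcup_open => U [].
(* A chart at [a0] is a radial sheet, since a ball is star-shaped about its centre. *)
- have [N [e [[oN Na iN e0] [Ne eN]]]] := chart a0.
  exists N => //; split=> // x t Nx /andP[t0 t1].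
  apply: eN; rewrite opprD addrA subrr add0r normrN normrZ ger0_norm //.
  by rewrite distrC (le_lt_trans _ (Ne _ Nx)) // ler_piMl.
- move=> x x' [U gU Ux] [V gV Vx']; exact: radial_sheet_agree gU gV Ux Vx'.
- move=> x t [U gU Ux] t01; have [_ _ _ rU] := gU.
  by have [z Uz fz] := rU x t Ux t01; exists z => //; exists U.
Qed.

Lemma maximal_sheet_max U x : radial_sheet U -> U x -> maximal_sheet x.
Proof. by move=> gU Ux; exists U. Qed.

Local Notation M := maximal_sheet.

(* The chart [N] around [q] over the ball of radius [e] is cut down to the points
   whose ray towards [y0] meets the maximal sheet inside [N]: adding them keeps
   the sheet radial, and injective because lifts of a ray are unique. *)
Lemma maximal_sheet_extend (N : set X) (w : Y) (e : R) (q x : X) (t : R) :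
  open N -> inj_on N -> (forall z, N z -> `|w - f z| < e) ->
  (forall y, `|w - y| < e -> exists2 z, N z & f z = y) ->
  N q -> M x -> N x -> 0 <= t <= 1 -> f x = y0 + t *: (f q - y0) -> M q.
Proof.
move=> oN iN Ne eN Nq Mx Nx t01 fx.
have [oM Ma iM rM] := maximal_sheet_radial.
pose N' : set X := [set z | N z /\ exists x' s,
  [/\ M x', N x', 0 <= s <= 1 & f x' = y0 + s *: (f z - y0)]].
suff gMN : radial_sheet (M `|` N').
  by apply: (maximal_sheet_max gMN); right; split=> //; exists x, t.
have agree m z : M m -> N' z -> f m = f z -> m = z.
  move=> Mm [Nz [x' [s [Mx' Nx' /andP[s0 s1] fx']]]] fmz.
  have [|||u [Mu Nu]] := lifts_agree (y := y0) (v := f z - y0) s1 oM oN iM iN.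
  - move=> r /andP[sr r1]; rewrite -fmz; apply: rM => //.
    by rewrite r1 (le_trans s0).
  - move=> r sr1; apply: eN; apply: (segment_in_ball sr1).
      by rewrite -fx'; exact: Ne.
    by rewrite subrKC; exact: Ne.
  - by exists x'.
  rewrite scale1r subrKC => fu.
  by rewrite -(iM u m) ?fmz // (iN u z).
split.
- apply: openU => //; rewrite openE => z [Nz [x' [s [Mx' Nx' s01 fx']]]].
  have nN : \forall z' \near z, N z' by apply: open_nbhs_nbhs; split.
  have cz : y0 + s *: (f z' - y0) @[z' --> z] --> y0 + s *: (f z - y0).
    apply: cvgD; first exact: cvg_cst.
    by apply: cvgZr; apply: cvgB; [exact: f_cont|exact: cvg_cst].
  have : nbhs (y0 + s *: (f z - y0)) (f @` (M `&` N)).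
    rewrite -fx'; apply: f_open; apply: open_nbhs_nbhs; split => //.
    exact: openI.
  move=> /cz; apply: filterS2 nN => z' Nz' [x2 [Mx2 Nx2] fx2].
  by split=> //; exists x2, s.
- by left.
- move=> z z' [Mz|N'z] [Mz'|N'z'] fzz'.
  + exact: iM.
  + exact: agree.
  + by apply/esym/agree.
  + by apply: iN => //; [case: N'z|case: N'z'].
- move=> z r [Mz|N'z] r01.
    by have [u Mu fu] := rM z r Mz r01; exists u => //; left.
  have [Nz [x' [s [Mx' Nx' /andP[s0 s1] fx']]]] := N'z.
  have /andP[r0 r1] := r01.
  (* The ray to [f z] is lifted in [M] up to the parameter [s] of [x'], and in [N] afterwards. For
     [r <= s] the lift comes from [rM] at [x']; for [r > s] it lies in [N], with [x'] at relative
     parameter [s / r]. *)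
  have [rs|sr] := leP r s.
    have [s00|sn0] := eqVneq s 0.
      exists a0; first by left.
      by have -> : r = 0; [apply/eqP; rewrite eq_le r0 -s00 rs|rewrite scale0r addr0].
    have sp : 0 < s by rewrite lt_neqAle eq_sym sn0.
    have [|u Mu fu] := rM x' (r / s) Mx'.
      by apply/andP; split; [exact: divr_ge0|rewrite ler_pdivrMr ?mul1r].
    exists u; first by left.
    by rewrite fu fx' addrAC subrr add0r scalerA divfK.
  have rp : 0 < r by rewrite (le_lt_trans s0).
  have [|u Nu fu] := eN (y0 + r *: (f z - y0)).
    apply: (@segment_in_ball _ _ _ _ _ _ s); first by rewrite ltW.
      by rewrite -fx'; exact: Ne.
    by rewrite subrKC; exact: Ne.
  exists u => //; right; split=> //; exists x', (s / r); split=> //.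
    by apply/andP; split; [exact/divr_ge0/ltW|rewrite ler_pdivrMr ?mul1r ?ltW].
  by rewrite fx' fu addrAC subrr add0r scalerA divfK ?gt_eqF.
Qed.

(* [l] lifts the half-open segment from [y0] to [y0 + t v] to the maximal sheet. *)
Section Ray.
Variables (v : Y) (t c : R) (l : R -> X).
Hypotheses (c0 : 0 < c)
  (c_exp : forall s, 0 <= s < t -> exists2 r, 0 < r & forall a b,
    `|l s - a| <= r -> `|l s - b| <= r -> c * `|a - b| <= `|f a - f b|)
  (Ml : forall s, 0 <= s < t -> M (l s))
  (fl : forall s, 0 <= s < t -> f (l s) = y0 + s *: v).

(** Openness provides a point of [M] near [l s] over the nearby parameter; injectivity on [M]
    identifies it with [l r], so [l] is continuous at [s] and the expansion estimate applies. *)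
Lemma lift_locally_lipschitz s : 0 <= s < t ->
  \forall r \near s, 0 <= r < t -> c * `|l s - l r| <= `|v| * `|s - r|.
Proof.
move=> st; have [oM _ iM _] := maximal_sheet_radial.
have [d d0 hd] := c_exp st.
have : nbhs (y0 + s *: v) (f @` (M `&` ball (l s) d)).
  rewrite -fl //; apply: f_open; apply: filterI; last exact: nbhsx_ballx.
  by apply: open_nbhs_nbhs; split=> //; exact: Ml.
move=> h; have : \forall r \near s, (f @` (M `&` ball (l s) d)) (y0 + r *: v).
  exact: (@continuous_ray _ _ y0 v s _ h).
apply: filterS => r [z [Mz]]; rewrite -ball_normE /= => /ltW sz fz rt.
have zE : z = l r by apply: iM; rewrite ?fl //; exact: Ml.
rewrite zE in sz.
have := hd (l s) (l r); rewrite subrr normr0 => /(_ (ltW d0) sz).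
by rewrite !fl // opprD addrACA subrr add0r -scalerBl normrZ mulrC [leRHS]mulrC.
Qed.

(** Real induction chains the local estimates: the constant is the same everywhere, although the
    neighbourhoods vary. *)
Lemma lift_lipschitz s r : 0 <= s -> s <= r -> r < t ->
  c * `|l s - l r| <= `|v| * (r - s).
Proof.
move=> s0 sr rt.
have inside u : s <= u <= r -> 0 <= u < t.
  by move=> /andP[su ur]; rewrite (le_trans s0) // (le_lt_trans ur).
have tri u u' : c * `|l s - l u| <= `|v| * (u - s) ->
    c * `|l u - l u'| <= `|v| * (u' - u) -> c * `|l s - l u'| <= `|v| * (u' - s).
  have : c * `|l s - l u'| <= c * (`|l s - l u| + `|l u - l u'|).
    by rewrite ler_pM2l // ler_distD.
  by lra.
apply: (real_induction (P := fun u => c * `|l s - l u| <= `|v| * (u - s)) sr).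
- by rewrite !subrr normr0 !mulr0.
- move=> u /andP[su ur] Pu.
  have /lift_locally_lipschitz : 0 <= u < t by apply: inside; rewrite su ltW.
  apply: filterS => u' hu' uu' u'r; apply: tri Pu _.
  have u't : 0 <= u' < t by apply: inside; rewrite u'r (le_trans su) // ltW.
  by have := hu' u't; rewrite [`|u - _|]distrC gtr0_norm ?subr_gt0.
- move=> u /andP[su ur] Pu.
  have /lift_locally_lipschitz hu : 0 <= u < t by apply: inside; rewrite ur ltW.
  have [u' [su' u'u hu']] := near_left_point su hu.
  apply: (tri u'); first by apply: Pu; rewrite su'.
  have u't : 0 <= u' < t by apply: inside; rewrite su' (le_trans (ltW u'u)).
  by rewrite distrC; have := hu' u't; rewrite (gtr0_norm (_ : 0 < u - u')) ?subr_gt0.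
Qed.

Lemma ray_endpoint : 0 < t -> exists2 q, M q & f q = y0 + t *: v.
Proof.
(* An increasing sequence from [s 0 = 0] to [t], with [t - s n = t * harmonic n]; the Lipschitz
   bound turns this into a Cauchy rate. *)
move=> t0; pose s n : R := t * (1 - harmonic n).
have h1 n : 0 < (harmonic n : R) <= 1.
  by rewrite invr_gt0 ltr0n /= invf_le1 ?ltr0n // ler1n.
have st n : 0 <= s n < t.
  have /andP[h0 h1n] := h1 n.
  by rewrite mulr_ge0 ?(ltW t0) ?subr_ge0 //= /s gtr_pMr // ltrBlDr ltrDl.
have s_mono n k : (n <= k)%N -> s n <= s k.
  move=> nk; rewrite ler_pM2l // lerD2l lerN2.
  by rewrite lef_pV2 ?posrE ?ltr0n // ler_nat.
have s_cvg : s n @[n --> \oo] --> t.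
  rewrite -[X in _ --> X]mulr1 -[X in _ --> t * X]subr0.
  apply: cvgM; first exact: cvg_cst.
  by apply: cvgB; [exact: cvg_cst|exact: cvg_harmonic].
have cv : cvgn (l \o s).
  apply: (@cauchy_rate_cvg _ _ _ (fun n => `|v| / c * t * harmonic n)).
    rewrite -[X in _ --> X](mulr0 (`|v| / c * t)).
    by apply: cvgM; [exact: cvg_cst|exact: cvg_harmonic].
  move=> n k nk /=; rewrite -(@ler_pM2l _ c) //.
  have /andP[sn0 _] := st n; have /andP[_ skt] := st k.
  rewrite (le_trans (lift_lipschitz sn0 (s_mono _ _ nk) skt)) //.
  have -> : c * (`|v| / c * t * harmonic n) = `|v| * (t * harmonic n).
    by field; rewrite gt_eqF ?ltr0n // gt_eqF.
  rewrite ler_wpM2l // /s -mulrBr ler_pM2l //.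
  by have /andP[] := h1 k; lra.
set q := limn (l \o s) in cv.
have fq : f q = y0 + t *: v.
  have c1 : f (l (s n)) @[n --> \oo] --> f q.
    exact: (cvg_comp _ _ cv (@f_cont q)).
  have c2 : f (l (s n)) @[n --> \oo] --> y0 + t *: v.
    under eq_fun do rewrite fl //.
    exact: (cvg_comp _ _ s_cvg (@continuous_ray _ _ y0 v t)).
  exact: (cvg_unique _ c1 c2).
exists q => //.
(* A chart at the limit [q] contains some [l (s n)], which is in [M] and lies on the ray to [f q],
   so [M] extends to [q]. *)
have [N [e [[oN Nq iN e0] [Ne eN]]]] := chart q.
have : nbhs q N by apply: open_nbhs_nbhs; split.
move=> /cv[n _ /(_ n (leqnn n)) /= Nn].
have /andP[sn0 snt] := st n.
apply: (maximal_sheet_extend oN iN Ne eN Nq (Ml (st n)) Nn (t := s n / t)).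
  by apply/andP; split; [exact/divr_ge0/ltW|rewrite ler_pdivrMr ?mul1r ?ltW].
by rewrite fl // fq addrAC subrr add0r scalerA divfK ?gt_eqF.
Qed.

End Ray.

Lemma maximal_sheet_surj p : exists2 q, M q & f q = p.
Proof.
have [oM Ma iM rM] := maximal_sheet_radial.
set v := p - y0.
have -> : p = y0 + 1 *: v by rewrite scale1r subrKC.
apply: (real_induction (P := fun t => exists2 q, M q & f q = y0 + t *: v) ler01).
- by exists a0; rewrite ?scale0r ?addr0.
- move=> t _ [q Mq fq].
  have h : nbhs (y0 + t *: v) (f @` M).
    by rewrite -fq; apply: f_open; apply: open_nbhs_nbhs; split.
  have : \forall s \near t, (f @` M) (y0 + s *: v).
    exact: (@continuous_ray _ _ y0 v t _ h).
  by apply: filterS => s [z Mz fz] _ _; exists z.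
move=> t /andP[t0 t1] ht.
(* The lift is made total with the dummy value [a0] outside [[0, t)]. *)
have /choice[l hl] : forall s, exists q, 0 <= s < t -> M q /\ f q = y0 + s *: v.
  move=> s; have [st|st] := boolP (0 <= s < t); last by exists a0.
  by have [q Mq fq] := ht s st; exists q.
(* The whole segment lies in this ball about 0, so one expansion constant serves along it. *)
have rho0 : 0 < `|y0| + `|v| + 1 by rewrite ltr_wpDl // addr_ge0.
have [c c0 hc] := f_expanding rho0.
apply: (@ray_endpoint v t c l c0) => //.
- move=> s st; apply: hc; rewrite (hl s st).2.
  have /andP[s0 st'] := st.
  rewrite (le_lt_trans (ler_normD _ _)) // normrZ ger0_norm //.
  have : s * `|v| <= `|v| by rewrite ler_piMl // (le_trans (ltW st')).
  by lra.
- by move=> s /hl[].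
- by move=> s /hl[].
Qed.

(** Real induction along the segment from [a0] to [x]. At a limit point [z], surjectivity gives [m]
    in [M] over [f z]; if [m] and [z] differed, points of the segment just before [z] would have
    second preimages in [M] near [m], against injectivity. *)
Lemma maximal_sheet_full x : M x.
Proof.
have [oM Ma iM rM] := maximal_sheet_radial.
set v := x - a0.
have -> : x = a0 + 1 *: v by rewrite scale1r subrKC.
have near_ray t W : nbhs (a0 + t *: v) W -> \forall s \near t, W (a0 + s *: v).
  exact: continuous_ray.
apply: (real_induction (P := fun t => M (a0 + t *: v)) ler01).
- by rewrite scale0r addr0.
- move=> t _ Mt; apply: filterS (near_ray t M _); last first.
    by apply: open_nbhs_nbhs; split.
  by [].
move=> t /andP[t0 t1] Mt; set z := a0 + t *: v in near_ray *.
have [m Mm fm] := maximal_sheet_surj (f z).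
have [<-//|mz] := eqVneq m z.
have := @norm_hausdorff _ X; rewrite open_hausdorff => /(_ _ _ mz).
move=> [[A A'] [/set_mem Am /set_mem A'z] [oA oA' /eqP AA']] /=.
have n1 : \forall s \near t, A' (a0 + s *: v).
  by apply: near_ray; apply: open_nbhs_nbhs; split.
have n2 : \forall s \near t, (f @` (M `&` A)) (f (a0 + s *: v)).
  apply: (near_ray _ (fun u => (f @` (M `&` A)) (f u))); apply: f_cont.
  rewrite -fm; apply: f_open; apply: open_nbhs_nbhs; split=> //.
  exact: openI.
have [s [s0 st [A's [m' [Mm' Am'] fm']]]] := near_left_point t0 (filterI n1 n2).
have m'E : m' = a0 + s *: v by apply: iM => //; apply: Mt; rewrite s0.
suff : (A `&` A') m' by rewrite [A `&` A']AA'.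
by split=> //; rewrite m'E.
Qed.

End GlobalInversion.

Section GlobalHomeomorphism.
Context (R : realType) (X : completeNormedModType R) (Y : normedModType R).
Variable f : X -> Y.
Hypothesis f_cont : continuous f.
Hypothesis f_open : forall x U, nbhs x U -> nbhs (f x) (f @` U).
Hypothesis f_expanding : forall rho : R, 0 < rho -> exists2 c, 0 < c &
  forall x, `|f x| < rho ->
  exists2 r, 0 < r & forall a b, `|x - a| <= r -> `|x - b| <= r ->
    c * `|a - b| <= `|f a - f b|.

Lemma global_inverse :
  exists g : Y -> X, [/\ cancel f g, cancel g f & continuous g].
Proof.
have full := maximal_sheet_full f_cont f_open f_expanding 0.
have [_ _ iM _] := maximal_sheet_radial f_cont f_open f_expanding 0.
have fi x x' : f x = f x' -> x = x' by apply: iM; exact: full.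
have /choice[g gK] : forall p, exists q, f q = p.
  move=> p.
  by have [q _ fq] := maximal_sheet_surj f_cont f_open f_expanding 0 p; exists q.
exists g; split=> // [x|p U /f_open]; first exact: fi.
rewrite gK.
by apply: filterS => _ [z Uz <-] /=; rewrite (fi (g (f z)) z).
Qed.

End GlobalHomeomorphism.

(** * The least-squares functional *)

Section HalfSquaredDistance.
Context (R : realType) (Y : hilbertType R) (y : Y).

Let q (u : Y) : R^o := 2^-1 * `|u - y| ^+ 2.

Lemma half_sqdist_littleo (u : Y) :
  q \o shift u = (cst (q u) + inner_form (u - y)) +o_ (0 : Y) id.
Proof.
apply/eqaddoP => e e0; near=> h.
rewrite /= !fctE /= /q -addrA.
(* The remainder is exactly [|h|^2 / 2]. *)
rewrite [X in `|X|](_ : _ = 2^-1 * `|h| * `|h|); last first.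
  by rewrite [`|h + _| ^+ 2]normD_sqr (innerC h); field.
rewrite !normrM normr_id ler_wpM2r // ger0_norm ?invr_ge0 //.
rewrite mulrC ler_pdivrMr //.
by near: h; apply: nbhs0_le; rewrite mulr_gt0.
Unshelve. all: by end_near. Qed.

Lemma is_diff_half_sqdist (u : Y) : is_diff u q (inner_form (u - y)).
Proof.
have c : continuous (inner_form (u - y)) by exact: continuous_inner.
have dq := diff_unique c (half_sqdist_littleo u).
apply: DiffDef => //; apply/diff_locallyP; rewrite dq; split=> //.
exact: half_sqdist_littleo.
Qed.

End HalfSquaredDistance.

Lemma opnorm_cvg0 (R : realType) (X Y : normedModType R) (T : X -> X -> Y) (x : X) :
  (forall e : R, 0 < e -> \forall z \near x, forall v, `|T z v| <= e * `|v|) ->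
  opnorm (T z) @[z --> x] --> 0%E.
Proof.
move=> hT A /= /nbhs_normP[e /= e0 eA].
have e2 : 0 < e / 2 by rewrite divr_gt0.
have := hT _ e2; apply: filterS => z Tz.
have le := opnorm_le (ltW e2) Tz.
have ge : (0 <= opnorm (T z))%E.
  by rewrite (le_trans _ (@opnorm_ge _ _ _ (T z) 0 _)) ?normr0 // lee_fin.
have fin : opnorm (T z) \is a fin_num.
  by rewrite ge0_fin_numE // (le_lt_trans le) // ltry.
have := eA (fine (opnorm (T z))); rewrite /= fineK //; apply.
rewrite sub0r normrN ger0_norm ?fine_ge0 // -lte_fin fineK //.
by rewrite (le_lt_trans le) // lte_fin; lra.
Qed.

Lemma gradientE (R : realType) (X : hilbertType R) (F : X -> R^o) (x : X) :
  differentiable F x -> forall v, 'd F x v = inner (gradient F x) v.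
Proof.
move=> dF; have /riesz[g hg] := diff_continuous dF.
rewrite /gradient; case: xgetP => [_ -> //|/(_ g)[]]; exact: hg.
Qed.

(** The infinite value, an infimum over the empty set, is covered by [c = 1]. *)
Lemma ereal_gt0_lower (R : realType) (m : \bar R) : (0 < m)%E ->
  exists2 c : R, 0 < c & (c%:E <= m)%E.
Proof.
by case: m => [r||] // m0; [exists r|exists 1; rewrite // leey].
Qed.

Section LeastSquares.
Context (R : realType) (X Y : hilbertType R) (f : X -> Y) (y : Y).
Hypothesis fC1 : C1 f.

Let F (x : X) : R^o := 2^-1 * `|f x - y| ^+ 2.

Lemma is_diff_least_squares x :
  is_diff x F (inner_form (f x - y) \o 'd f x).
Proof.
have df : is_diff x f ('d f x) by apply: DiffDef => //; exact: fC1.1.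
exact: (is_diff_comp df (is_diff_half_sqdist y (f x))).
Qed.

Lemma diff_least_squares x v : 'd F x v = inner (f x - y) ('d f x v).
Proof. by rewrite (diff_val (is_diff_def:=is_diff_least_squares x)). Qed.

Lemma C1_least_squares : C1 F.
Proof.
split=> x; first exact: (ex_diff (is_diff_def:=is_diff_least_squares x)).
apply: opnorm_cvg0 => e e0.
have [K K0 hK] := continuous_linear_bound (diff_continuous (fC1.1 x)).
pose N := `|f x - y| + 1.
have N0 : 0 < N by rewrite ltr_wpDl.
(* [e1] bounds the variation of ['d f] and [d] that of [f], so that each term of the splitting below
   is at most [e / 2 * |v|]; [K + e1] bounds ['d f z]. *)
pose e1 := e / 2 / N; have e10 : 0 < e1 by rewrite !divr_gt0.
pose d := e / 2 / (K + e1); have d0 : 0 < d by rewrite !divr_gt0 ?addr_gt0.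
have n1 := C1_near fC1 x e10.
have n2 : \forall z \near x, `|f x - f z| <= d.
  have cf : {for x, continuous f} by exact/differentiable_continuous/fC1.1.
  by move/cvgrPdist_le : cf; apply.
apply: filterS2 n1 n2 => z z1 z2 v.
rewrite !diff_least_squares.
have -> : inner (f z - y) ('d f z v) - inner (f x - y) ('d f x v) =
    inner (f x - y) ('d f z v - 'd f x v) - inner (f x - f z) ('d f z v).
  rewrite [in RHS]innerBr [RHS]addrAC -[in RHS]innerBl opprB.
  by rewrite [_ + (f z - _)]addrC addrA subrK.
have zK : `|'d f z v| <= (K + e1) * `|v|.
  rewrite -(subrK ('d f x v) ('d f z v)) (le_trans (ler_normD _ _)) //.
  by rewrite addrC mulrDl lerD.
rewrite (le_trans (ler_normB _ _)) //.
have h1 : `|inner (f x - y) ('d f z v - 'd f x v)| <= e / 2 * `|v|.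
  rewrite (le_trans (cauchy_schwarz _ _)) //.
  have -> : e / 2 * `|v| = N * (e1 * `|v|) by rewrite /e1; field; rewrite gt_eqF.
  by rewrite ler_pM // /N lerDl.
have h2 : `|inner (f x - f z) ('d f z v)| <= e / 2 * `|v|.
  rewrite (le_trans (cauchy_schwarz _ _)) //.
  have -> : e / 2 * `|v| = d * ((K + e1) * `|v|).
    by rewrite /d; field; rewrite gt_eqF ?addr_gt0.
  by rewrite ler_pM.
by lra.
Qed.

(** Pairing the gradient with the solution [v] of ['d f x v = f x - y] gives [|f x - y|^2], and
    [c |v| <= |f x - y|]. *)
Lemma gradient_least_squares_lower x c : 0 < c ->
  (forall v, c * `|v| <= `|'d f x v|) -> (forall w, exists v, 'd f x v = w) ->
  c * `|f x - y| <= `|gradient F x|.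
Proof.
move=> c0 hc hs; have [v vE] := hs (f x - y).
have [w0|w0] := eqVneq (f x - y) 0; first by rewrite w0 normr0 mulr0.
have nw0 : 0 < `|f x - y| by rewrite normr_gt0.
rewrite -(@ler_pM2r _ `|f x - y|) // -mulrA -expr2 -inner_norm -{2}vE.
rewrite -diff_least_squares gradientE; last first.
  exact: (ex_diff (is_diff_def:=is_diff_least_squares x)).
rewrite (@le_trans _ _ (c * (`|gradient F x| * `|v|))) //.
  by rewrite ler_pM2l // (le_trans (ler_norm _)) // cauchy_schwarz.
by rewrite mulrCA ler_wpM2l // -vE.
Qed.

End LeastSquares.

(** * From the Katriel condition to the PS-condition *)

Lemma katriel_lower_bound (R : realType) (X Y : hilbertType R) (f : X -> Y)
    (mu : X -> \bar R) :
  fredholm_map_index0 f ->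
  mu = (fun x => injectivity_modulus ('d f x)) \/
    mu = (fun x => surjectivity_modulus ('d f x)) ->
  katriel f mu -> forall rho : R, 0 < rho -> exists2 c, 0 < c &
  forall x, `|f x| < rho ->
    (forall v, c * `|v| <= `|'d f x v|) /\ (forall w, exists v, 'd f x v = w).
Proof.
move=> [fC1 fI] hmu [y0 hy0] rho rho0.
(* The ball of radius [rho] about 0 lies in the ball of this radius about [y0]. *)
have rho1 : 0 < rho + `|y0| by rewrite ltr_wpDr.
have [c c0 hc] := ereal_gt0_lower (hy0 _ rho1); exists c => // x fx.
have mux : (c%:E <= mu x)%E.
  apply: (le_trans hc); apply: ereal_inf_lbound; exists x => //=.
  by rewrite (le_lt_trans (ler_normB _ _)) // ltrD2r.
apply: modulus_lower_bound => //; first exact: diff_continuous (fC1.1 x).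
by case: hmu mux => ->; [left|right].
Qed.

Unset Implicit Arguments.

Theorem lemma17 (R : realType) (X Y : hilbertType R) (f : X -> Y)
    (mu : X -> \bar R)
    (hf : fredholm_map_index0 f)
    (hmu : mu = (fun x => injectivity_modulus ('d f x)) \/
           mu = (fun x => surjectivity_modulus ('d f x)))
    (hK : katriel f mu) (y : Y) :
  palais_smale (fun x : X => 2^-1 * `|f x - y| ^+ 2).
Proof.
have fC1 := hf.1; have lower := katriel_lower_bound hf hmu hK.
have f_cont : continuous f by move=> x; exact/differentiable_continuous/fC1.1.
have f_open x U : nbhs x U -> nbhs (f x) (f @` U).
  have fx0 : 0 < `|f x| + 1 by rewrite ltr_wpDl.
  have [c c0 hc] := lower _ fx0.
  have /hc[dfc dfs] : `|f x| < `|f x| + 1 by rewrite ltrDl.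
  by move=> xU; exact: (C1_locally_open fC1 c0 dfc dfs xU).
have f_exp (rho : R) : 0 < rho -> exists2 c, 0 < c & forall x, `|f x| < rho ->
    exists2 r, 0 < r & forall a b, `|x - a| <= r -> `|x - b| <= r ->
    c * `|a - b| <= `|f a - f b|.
  move=> /lower[c c0 hc]; exists (c / 2) => [|x /hc[dfc _]]; first exact: divr_gt0.
  exact: C1_locally_expanding fC1 _ _ c0 dfc.
have [g [fK gK g_cont]] := global_inverse f_cont f_open f_exp.
split; first exact: C1_least_squares.
(* The whole sequence converges, so the subsequence is the identity. *)
move=> x_ [B hB] hgrad; exists id => //.
have B0 : 0 <= B by rewrite (le_trans _ (hB 0%N)).
have fB n : `|f (x_ n)| < `|y| + (2 * B + 2).
  have h : `|f (x_ n) - y| ^+ 2 <= 2 * B.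
    by have := le_trans (ler_norm _) (hB n); lra.
  (* From [2 r <= r^2 + 1], which bounds [r] without a square root. *)
  have h' : `|f (x_ n) - y| < 2 * B + 2.
    have : 0 <= (`|f (x_ n) - y| - 1) ^+ 2 by rewrite sqr_ge0.
    by rewrite sqrrB1 mulr2n; have := normr_ge0 (f (x_ n) - y); lra.
  rewrite -(subrK y (f (x_ n))) (le_lt_trans (ler_normD _ _)) //.
  by rewrite addrC ltrD2l.
have rho0 : 0 < `|y| + (2 * B + 2) by have := normr_ge0 y; lra.
have [c c0 hc] := lower _ rho0.
have fx_cvg : f (x_ n) @[n --> \oo] --> y.
  apply/cvgrPdist_lt => e e0.
  have ce : 0 < c * e by rewrite mulr_gt0.
  have /cvgr0Pnorm_lt/(_ _ ce) := hgrad.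
  apply: filterS => n; rewrite normr_id => hn.
  have [dfc dfs] := hc _ (fB n).
  have := gradient_least_squares_lower y fC1 c0 dfc dfs.
  by move=> /le_lt_trans/(_ hn); rewrite ltr_pM2l // distrC.
(* Since [x_ n = g (f (x_ n))], continuity of the inverse [g] transports the limit. *)
apply/cvg_ex; exists (g y).
have := cvg_comp _ _ fx_cvg (g_cont y).
apply: cvg_trans; apply: near_eq_cvg; apply: nearW => n /=.
by rewrite fK.
Qed.
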